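(* Let $K$ be an infinite field and let $L_n$ be an $n$-dimensional null-filiform Leibniz algebra over $K$. Let $S\subseteq\mathcal D(X)$ be the set of all monomials of the following types: (i) $x_k$ with $k\ge1$; (ii) $x_jx_{i_1}^{(d_1)}x_{i_2}^{(d_2)}\cdots x_{i_r}^{(d_r)}$ with $0<d_1+\cdots+d_r\le n-2$, $1\le i_1<\cdots<i_r$ and $j,r\ge1$; (iii) $x_{j_1}x_{j_1}^{(d_1)}x_{j_2}^{(d_2)}\cdots x_{j_s}^{(d_s)}$ with $0<d_1+\cdots+d_s=n-1$, $1\le j_1<\cdots<j_s$ and $s\ge1$. Then $\{g+\mathrm{Id}(L_n): g\in S\}$ is a basis of the relatively free algebra $\mathcal D(X)/\mathrm{Id}(L_n)$ of $L_n$. In particular, if $m\ge1$, $$\dim\frac{\mathcal D(x_1,\dots,x_m)}{\mathrm{Id}(L_n)}=1+\binom{n+m-1}{m-1}+\sum_{s=1}^{n-1}\ \sum_{l=1}^{\min\{m,s\}} l\binom{m}{l}\binom{s-1}{l-1}.$$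
   Context: A Leibniz algebra over $K$ is a (not necessarily associative) $K$-algebra satisfying $x(yz)=(xy)z-(xz)y$ for all $x,y,z$. For a Leibniz algebra $L$ put $L^1=L$ and $L^{k+1}=L^kL$. An $n$-dimensional Leibniz algebra $L$ is null-filiform if $\dim L^i=n+1-i$ for $1\le i\le n+1$. It is known that every $n$-dimensional null-filiform Leibniz algebra is isomorphic to the algebra with basis $e_1,\dots,e_n$ and products $e_ie_1=e_{i+1}$ for $1\le i\le n-1$, all other products of basis elements being zero. Let $X=\{x_1,x_2,\dots\}$ be a countably infinite set and $\mathcal D(X)$ the free Leibniz $K$-algebra on $X$; $\mathcal D(x_1,\dots,x_m)$ is the free Leibniz algebra on $x_1,\dots,x_m$, regarded inside $\mathcal D(X)$. $\mathrm{Id}(L)$ is the set of all polynomial identities of $L$, i.e. of all $f\in\mathcal D(X)$ that lie in the kernel of every homomorphism $\mathcal D(X)\to L$, and $\mathcal D(x_1,\dots,x_m)/\mathrm{Id}(L_n)$ (the relatively free algebra of rank $m$ of $L_n$) means $\mathcal D(x_1,\dots,x_m)/(\mathcal D(x_1,\dots,x_m)\cap\mathrm{Id}(L_n))$. Products written without brackets are left-normed: $y_1y_2\cdots y_m=(\cdots((y_1y_2)y_3)\cdots)y_m$; and $ab^{(d)}=(\cdots((ab)b)\cdots)b$ with $d$ factors $b$ (so for $d=0$ the factor is omitted). The exponents $d_i$ are non-negative integers, and $S$ is regarded as a set of elements of $\mathcal D(X)$ (repetitions ignored).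
   Formalization: The leading summand ''1+'' in the dimension formula is dropped: as printed the formula is off by one in every case (for n = m = 1 the algebra K x_1 has dimension 1, while the printed formula gives 2). Also n ≥ 1 is stated explicitly. *)

(* Defs.v *)
From HB Require Import structures.
From mathcomp Require Import all_boot all_order all_algebra.
From mathcomp Require Import boolp classical_sets functions cardinality.

Set Implicit Arguments.
Unset Strict Implicit.
Unset Printing Implicit Defensive.

Import GRing.Theory.
Local Open Scope classical_set_scope.
Local Open Scope ring_scope.
Local Open Scope quotient_scope.

(* Right Leibniz algebras: right multiplications are derivations. *)
HB.mixin Record Lmodule_isLeibniz (K : fieldType) L of GRing.Lmodule K L := {
  lmul : L -> L -> L;
  lmulDl : forall x y z : L, lmul (x + y) z = lmul x z + lmul y z;
  lmulDr : forall x y z : L, lmul x (y + z) = lmul x y + lmul x z;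
  lmulZl : forall (a : K) (x y : L), lmul (a *: x) y = a *: lmul x y;
  lmulZr : forall (a : K) (x y : L), lmul x (a *: y) = a *: lmul x y;
  lmul_leibniz : forall x y z : L,
    lmul x (lmul y z) = lmul (lmul x y) z - lmul (lmul x z) y
}.

#[short(type="leibnizType")]
HB.structure Definition Leibniz (K : fieldType) :=
  { L of GRing.Lmodule K L & Lmodule_isLeibniz K L }.

#[short(type="finLeibnizType")]
HB.structure Definition FinLeibniz (K : fieldType) :=
  { L of Vector K L & Leibniz K L }.

Definition is_leibniz_hom (K : fieldType) (A B : leibnizType K) (h : A -> B) :=
  linear h /\ {morph h : u v / lmul u v}.

(* The free generators x_1, x_2, ... are x 0, x 1, ... *)
Definition is_free_leibniz (K : fieldType) (D : leibnizType K) (x : nat -> D) :=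
  forall (A : leibnizType K) (a : nat -> A),
    exists! h : D -> A, is_leibniz_hom h /\ forall i, h (x i) = a i.

Section NullFiliform.
Variables (K : fieldType) (L : finLeibnizType K).

(* As for prodv in falgebra: by bilinearity the products of basis elements span
   the same space as all the products u v with u in U and v in V. *)
Definition lmulv (U V : {vspace L}) : {vspace L} :=
  <<[seq lmul u v | u <- vbasis U, v <- vbasis V]>>%VS.

(* [lpow k] is L^k for k >= 1. *)
Definition lpow (k : nat) : {vspace L} :=
  iter k.-1 (fun U => lmulv U fullv) fullv.

Definition null_filiform (n : nat) :=
  \dim {:L} = n /\
  forall i, (1 <= i <= n.+1)%N -> \dim (lpow i) = (n + 1 - i)%N.

End NullFiliform.

Section QuotientModule.
Variables (K : fieldType) (V : lmodType K) (I : submodClosed V).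

Definition quot_pred : {pred V} := I.

Fact quot_pred_submod : subsemimod_closed quot_pred.
Proof.
by split=> [|a u]; [split; [exact: rpred0 | exact: rpredD] | exact: rpredZ].
Qed.
HB.instance Definition _ := GRing.isSubmodClosed.Build K V quot_pred
  quot_pred_submod.

Definition quotmod := Quotient.quot quot_pred.
HB.instance Definition _ := Choice.on quotmod.
HB.instance Definition _ := EqQuotient.on quotmod.
HB.instance Definition _ := GRing.Zmodule.on quotmod.

Definition quot_scale (a : K) (u : quotmod) : quotmod :=
  \pi_quotmod (a *: repr u).

Lemma eq_quotmod (u v : V) : \pi_quotmod u = \pi_quotmod v <-> u - v \in I.
Proof.
rewrite -[_ \in I]/(u - v \in quot_pred) Quotient.idealrBE.
by split=> [-> | /eqP].
Qed.

Lemma pi_quotmodD (u v : V) :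
  \pi_quotmod (u + v) = \pi_quotmod u + \pi_quotmod v.
Proof. exact: (Quotient.pi_add quot_pred u v). Qed.

Lemma pi_quotmodZ (a : K) (u : V) :
  \pi_quotmod (a *: u) = quot_scale a (\pi_quotmod u).
Proof.
apply/eq_quotmod; rewrite -scalerBr rpredZ //.
by apply/eq_quotmod; rewrite reprK.
Qed.

Let scaleA a b (u : quotmod) :
  quot_scale a (quot_scale b u) = quot_scale (a * b) u.
Proof.
by elim/quotW: u => u; rewrite -!(pi_quotmodZ _ u) -pi_quotmodZ scalerA.
Qed.

Let scale1 : left_id 1 quot_scale.
Proof. by elim/quotW=> u; rewrite -(pi_quotmodZ _ u) scale1r. Qed.

Let scaleDr : right_distributive quot_scale +%R.
Proof.
move=> a; elim/quotW=> u; elim/quotW=> v.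
by rewrite -pi_quotmodD -!(pi_quotmodZ a) scalerDr pi_quotmodD.
Qed.

Let scaleDl (u : quotmod) : {morph quot_scale^~ u : a b / a + b}.
Proof.
by elim/quotW: u => u a b; rewrite -!(pi_quotmodZ _ u) scalerDl pi_quotmodD.
Qed.

HB.instance Definition _ := GRing.Zmodule_isLmodule.Build K quotmod
  scaleA scale1 scaleDr scaleDl.

End QuotientModule.

Section Basis.
Variables (K : fieldType) (V : lmodType K).

Definition lin_indep (B : set V) := forall (s : seq V) (c : V -> K),
  uniq s -> [set` s] `<=` B -> \sum_(v <- s) c v *: v = 0 ->
  forall v, v \in s -> c v = 0.

Definition spanning (B : set V) := forall u : V,
  exists (s : seq V) (c : V -> K),
    [set` s] `<=` B /\ u = \sum_(v <- s) c v *: v.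

Definition is_basis (B : set V) := lin_indep B /\ spanning B.

Definition has_dim (d : nat) :=
  exists s : seq V, [/\ uniq s, size s = d & is_basis [set` s]].

End Basis.

Section Identities.
Variables (K : fieldType) (D L : leibnizType K).

(* Meaningful when D is the free Leibniz algebra on countably many generators. *)
Definition identities : {pred D} :=
  [pred f | `[< forall h : D -> L, is_leibniz_hom h -> h f = 0 >]].

Fact identities_submod : submod_closed identities.
Proof.
split=> [|a u v].
  by apply/asboolP => h [/(_ (-1) 0 0)]; rewrite !scaleN1r !addNr.
move=> /asboolP hu /asboolP hv; apply/asboolP => h hh.
by case: (hh) => -> _; rewrite hu // hv // scaler0 addr0.
Qed.
HB.instance Definition _ := GRing.isSubmodClosed.Build K D identities
  (GRing.submod_closed_semi identities_submod).

Definition relfree : lmodType K := quotmod identities.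

End Identities.

Arguments identities {K} D L.
Arguments relfree {K} D L.

Section GeneratedSubalgebra.
Variables (K : fieldType) (D : leibnizType K).

Definition is_subalgebra (A : set D) :=
  [/\ A 0, forall a u v, A u -> A v -> A (a *: u + v)
    & forall u v, A u -> A v -> A (lmul u v)].

Definition subalg_gen (G : set D) : {pred D} :=
  [pred f | `[< smallest is_subalgebra G f >]].

Variable G : set D.

Fact subalg_gen_submod : submod_closed (subalg_gen G).
Proof.
split=> [|a u v]; first by apply/asboolP => A [[]].
move=> /asboolP hu /asboolP hv; apply/asboolP => A GA.
by case: (GA) => -[_ lin _] _; apply: lin; [apply: hu | apply: hv].
Qed.
HB.instance Definition _ := GRing.isSubmodClosed.Build K D (subalg_gen G)
  (GRing.submod_closed_semi subalg_gen_submod).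

Record subalg := Subalg { subalg_val : D; _ : subalg_val \in subalg_gen G }.
HB.instance Definition _ := [isSub for subalg_val].
HB.instance Definition _ := [Choice of subalg by <:].
HB.instance Definition _ := [SubChoice_isSubLmodule of subalg by <:].

End GeneratedSubalgebra.

Section RelativelyFreeOfRank.
Variables (K : fieldType) (D : leibnizType K) (x : nat -> D).
Variables (L : leibnizType K) (m : nat).

(* The free Leibniz algebra on x_1, ..., x_m, inside D(X), is the subalgebra
   generated by x_1, ..., x_m. *)
Definition free_rank := subalg [set x i | i in `I_m].

Definition rank_identities : {pred free_rank} :=
  [pred f : free_rank | val f \in identities D L].

Fact rank_identities_submod : submod_closed rank_identities.
Proof.
split=> [|a u v]; first exact: rpred0.
by move=> hu hv; apply: (@rpredD _ (identities D L)) => //; apply: rpredZ.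
Qed.
HB.instance Definition _ := GRing.isSubmodClosed.Build K free_rank
  rank_identities rank_identities_submod.

Definition relfree_rank : lmodType K := quotmod rank_identities.

End RelativelyFreeOfRank.

Section Monomials.
Variables (K : fieldType) (D : leibnizType K) (x : nat -> D).

Definition rpow (a b : D) (d : nat) : D := iter d (fun u => lmul u b) a.

(* [mono j [:: (i_1, d_1); ...; (i_r, d_r)]] is the left-normed monomial
   x_j x_{i_1}^{(d_1)} ... x_{i_r}^{(d_r)}. *)
Definition mono (j : nat) (s : seq (nat * nat)) : D :=
  foldl (fun u p => rpow u (x p.1) p.2) (x j) s.

Definition basis_monomials (n : nat) : set D := [set f |
  [\/ exists k, f = x k,
      exists (j : nat) (s : seq (nat * nat)),
        [/\ (1 <= size s)%N, sorted ltn (unzip1 s),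
            (0 < sumn (unzip2 s) <= n - 2)%N & f = mono j s]
    | exists (j d : nat) (s : seq (nat * nat)),
        let t := (j, d) :: s in
        [/\ sorted ltn (unzip1 t), (0 < sumn (unzip2 t))%N,
            sumn (unzip2 t) = (n - 1)%N & f = mono j t]]].

End Monomials.

(* Main.v *)
Require Import Defs.
From HB Require Import structures.
From mathcomp Require Import all_boot all_order all_algebra.
From mathcomp Require Import zify.
From mathcomp Require Import boolp classical_sets functions cardinality.

Set Implicit Arguments.
Unset Strict Implicit.
Unset Printing Implicit Defensive.

Import GRing.Theory.
Local Open Scope classical_set_scope.
Local Open Scope ring_scope.
Local Open Scope quotient_scope.

(** Write [e^k] for the left-normed power of [e]. In a null-filiform algebra
    [L], choose [e] outside [L^2]; since [dim L/L^2 = 1], the powers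
    [e, ..., e^n] form a basis (lemma [null_filiform_coordinates]). The Leibniz
    identity makes right multiplication by [e^k] vanish for [k >= 2], so that
    [u v = v_1 (u e)] with [v_1] the coordinate of [v] along [e]. A left-normed
    word [x_j x_{i_1} ... x_{i_r}] therefore takes at [a_1, a_2, ...] the value
    of the product of the coordinates [(a_i)_1] over its last [r] letters, times
    the [r]-fold right multiplication of [a_j] by [e] (lemma [eval_word]). All
    the rest is read off this formula.

    Spanning. The value does not change when the last [r] letters are permuted;
    it is zero if [r >= n]; and if [r = n - 1] only [(a_j)_1] survives of [a_j],
    so that all letters may be permuted. Hence every word agrees modulo the
    identities with zero or with a [normal] word, that is, with one of the given
    monomials ([basis_monomials_normal]). The combinations of normal words are
    also closed under products modulo the identities ([reducible_mul]), so they
    exhaust the subalgebra generated by the letters, and the universal property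
    shows that the free algebra is generated by its letters
    ([free_leibniz_gen]).

    Independence. Evaluating a combination of normal words at
    [a_i = al_i e + be_i e^2] and comparing coordinates reduces the claim to the
    linear independence of distinct commutative monomials as functions on an
    infinite field ([monomials_indep]), proved by the substitution
    [x_i := t^(B^i)] with [B] large.

    Dimension. A normal word of length [s < n] is a letter together with a
    multiset of [s - 1] letters, and one of length [n] is a multiset of [n]
    letters. Multisets are counted by [card_sorted_tuples], and Vandermonde's
    convolution gives the stated form of the count ([marked_multisets]). *)

(** * Null-filiform algebras *)

Section LeibnizProduct.
Variables (K : fieldType) (A : leibnizType K).
Implicit Types u v : A.

Fact lmul_linear u : linear (lmul u).
Proof. by move=> a v w; rewrite lmulDr lmulZr. Qed.
HB.instance Definition _ u := GRing.isLinear.Build K A A *:%R (lmul u)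
  (lmul_linear u).

(** The operands are swapped so that [rmul v] is a linear map. *)
Definition rmul v u := lmul u v.

Fact rmul_linear v : linear (rmul v).
Proof. by move=> a u w; rewrite /rmul lmulDl lmulZl. Qed.
HB.instance Definition _ v := GRing.isLinear.Build K A A *:%R (rmul v)
  (rmul_linear v).

(** The left-normed power with [k + 1] factors. *)
Definition rpower e k : A := iter k (rmul e) e.

(** Since [x (e e) = (x e) e - (x e) e = 0], an induction with the Leibniz
    identity shows that right multiplication by any higher power is zero. *)
Lemma lmul_rpowerS u e k : lmul u (rpower e k.+1) = 0.
Proof.
elim: k u => [|k IHk] u; first by rewrite lmul_leibniz subrr.
rewrite -[rpower e k.+2]/(lmul (rpower e k.+1) e) lmul_leibniz !IHk.
by rewrite -[lmul 0 e]/(rmul e 0) linear0 subr0.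
Qed.

End LeibnizProduct.

Arguments rpower {K A} e k : simpl never.

Section NullFiliformStructure.
Variables (K : fieldType) (L : finLeibnizType K).
Implicit Types (U V W : {vspace L}) (u v : L).

Lemma lmulvP U V W :
  (lmulv U V <= W)%VS <-> {in U & V, forall u v, lmul u v \in W}.
Proof.
split=> [sW u v uU vV | mW].
  apply: (subvP sW); rewrite (coord_vbasis uU) (coord_vbasis vV).
  rewrite -/(rmul _ _) linear_sum; apply: rpred_sum => i _.
  rewrite linearZ rpredZ //= /rmul linear_sum; apply: rpred_sum => j _ /=.
  rewrite linearZ rpredZ //=; apply: memv_span.
  by apply: allpairs_f; rewrite mem_nth ?size_tuple.
apply/span_subvP => _ /allpairsP[[u v] /= [uU vV ->]].
by apply: mW; apply: vbasis_mem.
Qed.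

Lemma lmulv_mem U V u v : u \in U -> v \in V -> lmul u v \in lmulv U V.
Proof. by move: u v; apply/lmulvP. Qed.

Lemma lpowS k : (0 < k)%N -> lpow L k.+1 = lmulv (lpow L k) fullv.
Proof. by case: k. Qed.

Lemma lpow_sub k : (0 < k)%N -> (lpow L k.+1 <= lpow L k)%VS.
Proof.
case: k => // k _; elim: k => [|k IHk]; first exact: subvf.
rewrite (@lpowS k.+2) //; apply/lmulvP => u v uL vL.
by rewrite lpowS // lmulv_mem // (subvP IHk).
Qed.

(** The Leibniz identity moves a product standing on the right to two
    successive right multiplications. *)
Lemma lmul_lpow2 k u v :
  (0 < k)%N -> u \in lpow L k -> v \in lpow L 2 -> lmul u v \in lpow L k.+2.
Proof.
move=> k0 uL; suff: (lpow L 2 <= linfun (lmul u) @^-1: lpow L k.+2)%VS.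
  by move=> /subvP sL /sL; rewrite -memv_preim lfunE.
apply/lmulvP => a b _ _; rewrite -memv_preim lfunE /= lmul_leibniz.
by rewrite rpredB // !lpowS // !lmulv_mem ?memvf.
Qed.

(** [L = K e + L^2] forces [L^k = K e^k + L^(k+1)] for all [k], because
    [L^k L^2] lies in [L^(k+2)]. *)
Lemma lpow_line e k : (fullv <= <[e]> + lpow L 2)%VS -> (0 < k)%N ->
  (lpow L k <= <[rpower e k.-1]> + lpow L k.+1)%VS.
Proof.
move=> eL; case: k => // k _; elim: k => //= k IHk.
rewrite [lpow L _]lpowS //; apply/lmulvP => u v uL _.
have /memv_addP[_ /vlineP[b ->] [v' v'L ->]] := subvP eL v (memvf v).
have /memv_addP[_ /vlineP[a ->] [u' u'L Du]] := subvP IHk u uL.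
rewrite lmulDr lmulZr {1}Du lmulDl lmulZl scalerDr -addrA memv_add //.
  by rewrite !rpredZ // memv_line.
rewrite rpredD //; last exact: lmul_lpow2.
by rewrite rpredZ // lpowS // lmulv_mem ?memvf.
Qed.

(** The normal form of a null-filiform algebra: its basis is made of the
    powers [rpower e i] with [i < n], and a product depends on its right factor
    only through the coordinate [co 0] along [e]. *)
Lemma null_filiform_coordinates n : null_filiform L n -> (0 < n)%N ->
  exists (e : L) (co : nat -> {scalar L}),
  [/\ forall u v, lmul u v = co 0%N v *: lmul u e,
      forall k j, (k < n)%N -> co k (rpower e j) = (j == k)%:R
    & forall u, u = \sum_(i < n) co i u *: rpower e i].
Proof.
case: n => // n [dimL dim_lpow] _.
(* [L/L^2] is a line, so any [e] outside [L^2] works. *)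
have [e eL]: exists e, e \notin lpow L 2.
  apply: contrapT => /forallNP nL.
  have: (fullv <= lpow L 2)%VS by apply/subvP=> u _; apply/negPn/negP/nL.
  by move/dimvS; rewrite dimL dim_lpow // addn1 subSS subn1 ltnn.
have fullE : (fullv <= <[e]> + lpow L 2)%VS.
  have /eqP-> // : (<[e]> + lpow L 2 == fullv)%VS.
  rewrite eqEdim subvf dimL dimv_disjoint_sum.
    rewrite dim_vline dim_lpow // addn1 subSS subn1 /=.
    by case: eqP eL => // ->; rewrite mem0v.
  apply/eqP; rewrite -subv0; apply/subvP => u; rewrite memv_cap.
  case/andP=> /vlineP[a ->]; have [-> | a0] := eqVneq a 0.
    by rewrite scale0r !mem0v.
  by rewrite rpredZeq (negPf a0) (negPf eL).
have e_lpow k : rpower e k \in lpow L k.+1.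
  by elim: k => [|k IHk]; rewrite ?memvf // lpowS // lmulv_mem ?memvf.
have lpow_n : lpow L n.+2 = 0%VS.
  by apply/eqP; rewrite -dimv_eq0 dim_lpow ?addn1 ?subnn /=.
pose X := [tuple rpower e i | i < n.+1].
have XE (i : 'I_n.+1) : X`_i = rpower e i by rewrite -tnth_nth tnth_mktuple.
have fullX : basis_of fullv X.
  rewrite basisEdim size_tuple dimL leqnn andbT.
  (* Since [n + 1] vectors are to form a basis, it is enough that they span. *)
  suff: forall k, (k <= n.+1)%N -> (fullv <= <<X>> + lpow L k.+1)%VS.
    by move/(_ _ (leqnn _)); rewrite lpow_n addv0.
  elim=> [|k IHk] ltkn; first exact: addvSr.
  apply: subv_trans (IHk (ltnW ltkn)) _; rewrite subv_add addvSl /=.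
  apply: subv_trans (lpow_line fullE _) _ => //.
  rewrite subv_add addvSr andbT -memvE (subvP (addvSl _ _)) //.
  by rewrite -(XE (Ordinal ltkn)) memv_span // mem_nth // size_tuple.
have rpower0 k : (n < k)%N -> rpower e k = 0.
  move=> ltnk; apply/eqP; rewrite -memv0 -lpow_n.
  rewrite -(subnK ltnk); elim: (k - n.+1)%N => [|d IHd]; first exact: e_lpow.
  have := lpow_sub (ltn0Sn n.+1) => /subvP; apply.
  by rewrite [lpow L _]lpowS // addSn lmulv_mem ?memvf.
pose co k : {scalar L} := coord X (inord k).
have coE k j : (k < n.+1)%N -> co k (rpower e j) = (j == k)%:R.
  move=> ltkn; have [ltjn | lenj] := ltnP j n.+1; last first.
    rewrite rpower0 // linear0; case: eqP => // Djk.
    by rewrite Djk leqNgt ltkn in lenj.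
  rewrite -(XE (Ordinal ltjn)) [LHS]coord_free ?(basis_free fullX) //.
  by rewrite -val_eqE /= inordK // eq_sym.
have coS u : u = \sum_(i < n.+1) co i u *: rpower e i.
  rewrite {1}(coord_basis fullX (memvf u)); apply: eq_bigr => i _.
  by rewrite XE /co inord_val.
exists e, co; split=> // u v.
rewrite {1}(coS v) linear_sum big_ord_recl big1 ?addr0 ?linearZ //= => i _.
by rewrite linearZ /= lmul_rpowerS scaler0.
Qed.

End NullFiliformStructure.

(** * Bases of quotient modules *)

Section QuotientBasis.
Variables (K : fieldType) (V : lmodType K) (I : submodClosed V).

Lemma pi_quotmod_sum (T : Type) (s : seq T) (c : T -> K) (b : T -> V) :
  \pi_(quotmod I) (\sum_(q <- s) c q *: b q) =
  \sum_(q <- s) c q *: \pi_(quotmod I) (b q).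
Proof.
elim: s => [|q s IHs]; last by rewrite !big_cons pi_quotmodD pi_quotmodZ IHs.
rewrite !big_nil; apply: (addIr (\pi_(quotmod I) 0)).
by rewrite -pi_quotmodD !add0r.
Qed.

Lemma pi_quotmod_eq0 (v : V) : \pi_(quotmod I) v = 0 <-> v \in I.
Proof.
have := pi_quotmod_sum [::] (fun _ : nat => 0) (fun=> v).
rewrite !big_nil => <-; rewrite -{2}[v]subr0; exact: eq_quotmod.
Qed.

Variables (T : choiceType) (N : set T) (b : T -> V).

(** Families are indexed by words rather than given as sets of vectors: distinct
    normal words are known to name distinct classes only after independence
    is established. *)
Definition indep_mod := forall (s : seq T) (c : T -> K),
  uniq s -> [set` s] `<=` N -> \sum_(q <- s) c q *: b q \in I ->
  forall q, q \in s -> c q = 0.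

(** Coefficients are attached to the positions of a list, which may repeat an
    index, so that combinations can simply be concatenated. *)
Definition spans_mod := forall u : V, exists l : seq (K * T),
  {in l, forall p, N p.2} /\ u - \sum_(p <- l) p.1 *: b p.2 \in I.

(** If two indices named the same class, the difference of the two vectors would
    be a nontrivial relation. *)
Lemma indep_mod_inj : indep_mod ->
  {in N &, injective (\pi_(quotmod I) \o b)}.
Proof.
move=> indep q q'; rewrite !inE => Nq Nq' /= /eq_quotmod eq_qq'.
apply/eqP/negPn/negP => neq_qq'.
pose c r : K := if r == q then 1 else -1.
suff: c q = 0 by rewrite /c eqxx => /eqP; rewrite oner_eq0.
apply: (indep [:: q; q'] c); last exact: mem_head.
- by rewrite /= inE neq_qq'.
- by move=> r /=; rewrite !inE => /orP[] /eqP->.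
rewrite !big_cons big_nil addr0 /c eqxx eq_sym (negPf neq_qq').
by rewrite scale1r scaleN1r.
Qed.

Lemma quotmod_basis : indep_mod -> spans_mod ->
  is_basis [set \pi_(quotmod I) (b q) | q in N].
Proof.
move=> indep span; split=> [s c Us sN c0 v vs | u].
  have [ws Dws Nws]: exists2 ws, s = [seq \pi_(quotmod I) (b q) | q <- ws]
      & [set` ws] `<=` N.
    elim: s sN {Us c0 vs} => [|v' s IHs] sN; first by exists [::].
    have [|ws -> Nws] := IHs.
      by move=> w ws; apply: sN; rewrite /= inE (_ : w \in s) ?orbT.
    have [|q Nq <-] := sN v'; first exact: mem_head.
    by exists (q :: ws) => // r /=; rewrite inE => /predU1P[-> // | /Nws].
  move: c0 vs Us; rewrite {s sN}Dws big_map => c0 /mapP[q qws ->] Us.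
  have := indep ws (fun q => c (\pi_(quotmod I) (b q))).
  apply=> //; first exact: map_uniq Us.
  by apply/pi_quotmod_eq0; rewrite pi_quotmod_sum.
(* The coefficients of all terms in the same class are collected. *)
elim/quotW: u => u; have [l [Nl /eq_quotmod->]] := span u.
pose s := [seq \pi_(quotmod I) (b p.2) | p <- l].
exists (undup s).
exists (fun v => \sum_(p <- l | \pi_(quotmod I) (b p.2) == v) p.1).
split=> [v /=|].
  by rewrite mem_undup => /mapP[p pl ->]; exists p.2 => //; apply: Nl.
rewrite pi_quotmod_sum.
under [RHS]eq_bigr do rewrite scaler_suml.
rewrite (exchange_big_dep predT) //= [LHS]big_seq [RHS]big_seq.
apply: eq_bigr => p pl.
rewrite big_mkcond (bigD1_seq (\pi_(quotmod I) (b p.2))) ?undup_uniq //=.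
  by rewrite eqxx big1 ?addr0 // => v; rewrite eq_sym => /negPf->.
by rewrite mem_undup; apply/mapP; exists p.
Qed.

End QuotientBasis.

(** * Monomials in several variables over an infinite field *)

Section KroneckerSubstitution.

(** Uniqueness of the expansion in base [B]. *)
Lemma digits_inj (B N : nat) (f g : nat -> nat) :
  (forall i, f i < B)%N -> (forall i, g i < B)%N ->
  (\sum_(i < N) f i * B ^ i = \sum_(i < N) g i * B ^ i)%N ->
  forall i, (i < N)%N -> f i = g i.
Proof.
elim: N f g => // N IHN f g ltfB ltgB.
have B0 : (0 < B)%N by apply: leq_ltn_trans (ltfB 0%N).
have recl (h : nat -> nat) :
    (\sum_(i < N.+1) h i * B ^ i = (\sum_(i < N) h i.+1 * B ^ i) * B + h 0)%N.
  rewrite big_ord_recl muln1 addnC big_distrl /=; congr (_ + _)%N.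
  by apply: eq_bigr => i _; rewrite expnS mulnCA mulnC.
rewrite !recl => eq_fg.
have eq0 : f 0%N = g 0%N.
  by have := congr1 (modn^~ B) eq_fg; rewrite /= !modnMDl !modn_small.
move/eqP: eq_fg; rewrite eq0 eqn_add2r eqn_pmul2r // => /eqP eqS.
by case=> [_|i] //; apply: (IHN (f \o S) (g \o S)) => // j; rewrite /= ?ltfB.
Qed.

(** The exponent of [t] in the product of the [x_i] with [i] in [w], after
    substituting [t ^ (B ^ i)] for [x_i]. *)
Definition kronecker (B : nat) (w : seq nat) : nat := (\sum_(i <- w) B ^ i)%N.

Lemma kronecker_count B N w : all (gtn N) w ->
  kronecker B w = (\sum_(i < N) count_mem (i : nat) w * B ^ i)%N.
Proof.
rewrite /kronecker; elim: w => [|k w IHw] /=.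
  by rewrite big_nil big1 // => i; rewrite mul0n.
case/andP=> ltkN /IHw; rewrite big_cons => ->.
under [RHS]eq_bigr do rewrite mulnDl.
rewrite big_split /=; congr (_ + _)%N.
rewrite (bigD1 (Ordinal ltkN)) //= eqxx mul1n big1 ?addn0 // => i.
by rewrite -val_eqE /= eq_sym => /negPf->; rewrite mul0n.
Qed.

(** The multiplicities of the letters are the digits of the exponent in base
    [B], and they determine a sorted word. *)
Lemma kronecker_inj B w w' :
  (size w < B)%N -> (size w' < B)%N -> sorted leq w -> sorted leq w' ->
  kronecker B w = kronecker B w' -> w = w'.
Proof.
move=> ltwB ltw'B sw sw'; pose N := (\max_(i <- w ++ w') i).+1.
have /andP[leN leN']: all (gtn N) w && all (gtn N) w'.
  rewrite -all_cat; apply/allP => i iw /=; rewrite ltnS.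
  exact: (@leq_bigmax_seq _ _ xpredT id).
rewrite !(@kronecker_count _ N) // => eqE.
apply: (sorted_eq leq_trans anti_leq) => //; apply/permP => a.
apply/permP: a; apply/allP => i iw; apply/eqP.
apply: (digits_inj (f := fun i => count_mem i w)
                   (g := fun i => count_mem i w') _ _ eqE).
- by move=> j; apply: leq_ltn_trans (count_size _ _) _.
- by move=> j; apply: leq_ltn_trans (count_size _ _) _.
by move: iw; rewrite mem_cat => /orP[/(allP leN) | /(allP leN')].
Qed.

Lemma poly_eq0_infinite (K : fieldType) (p : {poly K}) :
  infinite_set [set: K] -> (forall t, p.[t] = 0) -> p = 0.
Proof.
move=> /(@infinite_set_fset _ _ (size p))[B _ leB] p0.
apply/eqP/negPn/negP => nz_p.
have: all (root p) (finmap.enum_fset B) by apply/allP => t _; apply/rootP.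
by move/(max_poly_roots nz_p)/(_ (finmap.fset_uniq B)); rewrite ltnNge leB.
Qed.

(** Monomials are encoded by sorted words of letters. Substituting
    [t ^ (B ^ i)] for [x_i] turns distinct monomials of degree less than [B]
    into distinct powers of [t], which reduces the claim to one variable. *)
Lemma monomials_indep (K : fieldType) (T : eqType) (s : seq T)
    (f : T -> seq nat) (c : T -> K) :
  infinite_set [set: K] ->
  uniq s -> {in s &, injective f} -> {in s, forall q, sorted leq (f q)} ->
  (forall al : nat -> K, \sum_(q <- s) c q * \prod_(i <- f q) al i = 0) ->
  {in s, forall q, c q = 0}.
Proof.
move=> infK Us f_inj sf f0 q0 q0s.
pose B := (\max_(q <- s) size (f q)).+1.
have ltB q : q \in s -> (size (f q) < B)%N.
  by move=> qs; rewrite ltnS (@leq_bigmax_seq _ _ xpredT (size \o f)).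
pose p := \sum_(q <- s) c q *: 'X^(kronecker B (f q)).
have p0 : p = 0.
  apply: poly_eq0_infinite infK _ => t; rewrite horner_sum.
  rewrite -[RHS](f0 (fun i => t ^+ (B ^ i))).
  apply: eq_bigr => q _; rewrite hornerZ hornerXn; congr (_ * _).
  by rewrite /kronecker; elim/big_rec2: _ => [|i x y _ <-] //; rewrite -exprD.
have /(congr1 (fun r : {poly K} => r`_(kronecker B (f q0)))) := p0.
rewrite coef0 coef_sum (bigD1_seq q0) //= coefZ coefXn eqxx mulr1.
rewrite big_seq_cond big1 ?addr0 // => q /andP[qs neq].
rewrite coefZ coefXn; case: eqP => [eqf | _]; last exact: mulr0.
case/eqP: neq; apply: f_inj => //.
by apply: (@kronecker_inj B); rewrite ?ltB ?sf.
Qed.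

End KroneckerSubstitution.

(** * Words and left-normed monomials *)

Section Words.

(** The pair [(j, w)] stands for the left-normed product of [x_j] with the
    letters of [w]. *)
Definition word := (nat * seq nat)%type.

Definition normal (n : nat) (q : word) :=
  [&& sorted leq q.2, (size q.2 < n)%N
    & ((size q.2).+1 == n) ==> sorted leq (q.1 :: q.2)].

Lemma mem_tally_seq (T : eqType) (s : seq (T * nat)) :
  {subset tally_seq s <= unzip1 s}.
Proof.
move=> i /flatten_mapP[p ps]; rewrite mem_nseq => /andP[_ /eqP->].
exact: map_f.
Qed.

Lemma sorted_tally_seq (s : seq (nat * nat)) :
  sorted ltn (unzip1 s) -> sorted leq (tally_seq s).
Proof.
rewrite !sorted_pairwise; [|exact: leq_trans|exact: ltn_trans].
elim: s => //= -[i d] s IHs /= /andP[/allP lti /IHs srt].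
rewrite /tally_seq /= pairwise_cat srt andbT; apply/andP; split.
  apply/allrelP => a b; rewrite mem_nseq => /andP[_ /eqP->] /mem_tally_seq bs.
  exact/ltnW/lti.
by elim: d => //= d ->; rewrite andbT all_nseq leqnn orbT.
Qed.

Lemma tally_seq_iota a b w : sorted leq w ->
  {in w, forall i, (a <= i < a + b)%N} ->
  tally_seq [seq (i, count_mem i w) | i <- iota a b] = w.
Proof.
move=> sw abw; apply: (sorted_eq leq_trans anti_leq) => //.
  apply: sorted_tally_seq; rewrite /unzip1 -map_comp map_id_in //.
  exact: iota_ltn_sorted.
have count_tally (s : seq nat) k : uniq s ->
    count_mem k (tally_seq [seq (i, count_mem i w) | i <- s]) =
    ((k \in s) * count_mem k w)%N.
  elim: s => //= i s IHs /andP[nis /IHs IH].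
  rewrite count_cat count_nseq {}IH [_ \in _ :: _]inE /= [i == k]eq_sym.
  by case: eqVneq => [->|_] //=; rewrite (negPf nis) addn0.
apply/allP => k; rewrite mem_cat /= count_tally ?iota_uniq // mem_iota => kw.
case abk: (a <= k < a + b)%N; first by rewrite mul1n.
case/orP: kw => [/mem_tally_seq|/abw]; last by rewrite abk.
by rewrite /unzip1 -map_comp map_id_in // mem_iota abk.
Qed.

Variables (K : fieldType) (D : leibnizType K) (x : nat -> D).

Definition word_mono (q : word) : D :=
  foldl (fun u i => lmul u (x i)) (x q.1) q.2.

Lemma mono_word j s : mono x j s = word_mono (j, tally_seq s).
Proof.
rewrite /mono /word_mono /=; elim: s (x j) => //= -[i d] s IHs u.
rewrite IHs /tally_seq /= foldl_cat; congr foldl.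
by rewrite /rpow /=; elim: d u => //= d IHd u; rewrite -IHd -iterSr.
Qed.

(** Exponents of a given monomial may be zero and different exponent sequences
    may give the same monomial, so it is represented by its word instead. *)
Lemma basis_monomials_normal n : (0 < n)%N ->
  basis_monomials x n = [set word_mono q | q in [set q | normal n q]].
Proof.
move=> n0; apply/seteqP; split=> f /=.
  case=> [[k ->] | [j [s [s0 srt /andP[pos le] ->]]] |
          [j [d [s [srt pos eqn ->]]]]].
  - by exists (k, [::]); rewrite // /normal /= n0 implybT.
  - exists (j, tally_seq s); rewrite -?mono_word // /normal /=.
    rewrite sorted_tally_seq // size_tally_seq.
    by rewrite (_ : (_ == n) = false) ?andbT /=; lia.
  exists (j, tally_seq ((j, d) :: s)); rewrite -?mono_word // /normal.
  have srt' := sorted_tally_seq srt.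
  rewrite size_tally_seq eqn srt' /=; apply/andP; split; first by lia.
  apply/implyP => _; rewrite path_min_sorted //.
  apply/allP => i /mem_tally_seq; rewrite inE => /predU1P[-> // | iS].
  by apply/ltnW; move: srt => /= /(order_path_min ltn_trans)/allP; apply.
case=> -[j w] /and3P[/= sw ltwn srt] <-.
have [N N0 ltN] : exists2 N, (0 < N)%N & forall i, i \in w -> (i < N)%N.
  exists (\max_(i <- w) i).+1 => // i iw.
  by rewrite ltnS (@leq_bigmax_seq _ _ xpredT id).
have [-> | nz_w] := eqVneq w [::]; first by constructor 1; exists j.
have w0 : (0 < size w)%N by case: (w) nz_w.
have keysE a b : unzip1 [seq (i, count_mem i w) | i <- iota a b] = iota a b.
  by rewrite /unzip1 -map_comp map_id_in.
(* As exponents may be zero, an interval containing all letters serves as the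
   list of indices. *)
have [eqn | neqn] := eqVneq (size w).+1 n; last first.
  constructor 2; exists j, [seq (i, count_mem i w) | i <- iota 0 N].
  rewrite mono_word keysE -size_tally_seq tally_seq_iota //.
  split=> //; rewrite ?size_map ?size_iota ?iota_ltn_sorted // w0 /=.
  by move: neqn ltwn; clear; lia.
constructor 3; exists j, (count_mem j w).
exists [seq (i, count_mem i w) | i <- iota j.+1 N].
move=> t; have -> : t = [seq (i, count_mem i w) | i <- iota j N.+1] by [].
rewrite mono_word keysE -size_tally_seq tally_seq_iota //; last first.
  move=> i iw; move: srt; rewrite eqn eqxx /=.
  move=> /(order_path_min leq_trans)/allP.
  move=> /(_ i iw) leji; rewrite leji (leq_trans (ltN i iw)) //.
  by rewrite addnS ltnW // ltnS leq_addl.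
by rewrite iota_ltn_sorted; split=> //; rewrite -?eqn ?subn1.
Qed.

End Words.

(** * Generation of the free Leibniz algebra *)

Section LeibnizHom.
Variables (K : fieldType) (A B : leibnizType K) (h : A -> B).
Hypothesis hom_h : is_leibniz_hom h.

Lemma leibniz_homZD a u v : h (a *: u + v) = a *: h u + h v.
Proof. by have [lin _] := hom_h; apply: lin. Qed.

Lemma leibniz_homM u v : h (lmul u v) = lmul (h u) (h v).
Proof. by have [_ mor] := hom_h; apply: mor. Qed.

Lemma leibniz_hom0 : h 0 = 0.
Proof. by have := leibniz_homZD (-1) 0 0; rewrite !scaleN1r !addNr. Qed.

Lemma leibniz_homB u v : h (u - v) = h u - h v.
Proof. by rewrite addrC -scaleN1r leibniz_homZD scaleN1r addrC. Qed.

Lemma leibniz_hom_sum (T : Type) (s : seq T) (c : T -> K) (b : T -> A) :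
  h (\sum_(q <- s) c q *: b q) = \sum_(q <- s) c q *: h (b q).
Proof.
elim: s => [|q s IHs]; first by rewrite !big_nil leibniz_hom0.
by rewrite !big_cons leibniz_homZD IHs.
Qed.

End LeibnizHom.

Section SubalgebraLeibniz.
Variables (K : fieldType) (D : leibnizType K) (G : set D).

Lemma subalg_gen_mul u v : u \in subalg_gen G -> v \in subalg_gen G ->
  lmul u v \in subalg_gen G.
Proof.
move=> /asboolP uG /asboolP vG; apply/asboolP => A GA.
by case: (GA) => -[_ _ mul] _; apply: mul; [apply: uG | apply: vG].
Qed.

Lemma subalg_gen_sub u : G u -> u \in subalg_gen G.
Proof. by move=> Gu; apply/asboolP => A [_]; apply. Qed.

Definition sub_lmul (u v : subalg G) : subalg G :=
  Subalg (subalg_gen_mul (valP u) (valP v)).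

Fact sub_lmulDl (u v w : subalg G) :
  sub_lmul (u + v) w = sub_lmul u w + sub_lmul v w.
Proof. by apply: val_inj; rewrite /= lmulDl. Qed.
Fact sub_lmulDr (u v w : subalg G) :
  sub_lmul u (v + w) = sub_lmul u v + sub_lmul u w.
Proof. by apply: val_inj; rewrite /= lmulDr. Qed.
Fact sub_lmulZl (a : K) (u v : subalg G) :
  sub_lmul (a *: u) v = a *: sub_lmul u v.
Proof. by apply: val_inj; rewrite /= lmulZl. Qed.
Fact sub_lmulZr (a : K) (u v : subalg G) :
  sub_lmul u (a *: v) = a *: sub_lmul u v.
Proof. by apply: val_inj; rewrite /= lmulZr. Qed.
Fact sub_lmul_leibniz (u v w : subalg G) : sub_lmul u (sub_lmul v w) =
  sub_lmul (sub_lmul u v) w - sub_lmul (sub_lmul u w) v.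
Proof. by apply: val_inj; rewrite /= lmul_leibniz. Qed.

HB.instance Definition _ := Lmodule_isLeibniz.Build K (subalg G)
  sub_lmulDl sub_lmulDr sub_lmulZl sub_lmulZr sub_lmul_leibniz.

End SubalgebraLeibniz.

Lemma word_mono_gen (K : fieldType) (D : leibnizType K) (x : nat -> D)
    (P : set nat) q : {in q.1 :: q.2, forall i, P i} ->
  word_mono x q \in subalg_gen [set x i | i in P].
Proof.
case: q => j w /= Pjw; have xG i : P i -> x i \in subalg_gen [set x i | i in P].
  by move=> Pi; apply: subalg_gen_sub; exists i.
rewrite /word_mono /=; elim/last_ind: w Pjw => [|w i IHw] Pjw /=.
  by apply/xG/Pjw/mem_head.
rewrite foldl_rcons; apply: subalg_gen_mul.
  apply: IHw => k; rewrite inE => kw; apply: Pjw.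
  by rewrite inE mem_rcons inE; case/orP: kw => ->; rewrite ?orbT.
by apply/xG/Pjw; rewrite inE mem_rcons mem_head orbT.
Qed.

(** The inclusion of the generated subalgebra is split by the universal
    property, and uniqueness makes the resulting endomorphism the identity. *)
Lemma free_leibniz_gen (K : fieldType) (D : leibnizType K) (x : nat -> D) :
  is_free_leibniz x -> forall f, f \in subalg_gen [set x i | i in [set: nat]].
Proof.
move=> freeD f; set G := [set x i | i in _].
have xG i : x i \in subalg_gen G by apply: subalg_gen_sub; exists i.
have [h [[hom_h hx] _]] := freeD (subalg G) (fun i => Subalg (xG i)).
have [g [_ g_uniq]] := freeD D x.
have eq_gh : g = val \o h.
  apply: g_uniq; split=> [|i]; last by rewrite /= hx.
  split=> [a u v|u v] /=; first by rewrite (leibniz_homZD hom_h).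
  by rewrite (leibniz_homM hom_h).
have eq_gid : g = id by apply: g_uniq.
suff -> : f = val (h f) by apply: valP.
by rewrite -[RHS]/((val \o h) f) -eq_gh eq_gid.
Qed.

(** * Identities of a null-filiform algebra *)

Section NullFiliformIdentities.
Variables (K : fieldType) (L : leibnizType K) (n : nat).
Variables (e : L) (co : nat -> {scalar L}).
Hypothesis n0 : (0 < n)%N.
Hypothesis lmulE : forall u v : L, lmul u v = co 0%N v *: lmul u e.
Hypothesis co_rpower :
  forall k j, (k < n)%N -> co k (rpower e j) = (j == k)%:R.
Hypothesis coE : forall u, u = \sum_(i < n) co i u *: rpower e i.

Lemma rpower_eq0 k : (n <= k)%N -> rpower e k = 0.
Proof.
move=> lenk; rewrite [LHS]coE big1 // => i _.
by rewrite co_rpower // gtn_eqF ?scale0r // (leq_trans (ltn_ord i)).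
Qed.

Lemma iter_rmulE k u :
  iter k (rmul e) u = \sum_(i < n) co i u *: rpower e (k + i).
Proof.
elim: k => [|k IHk] /=; first exact: coE.
by rewrite IHk linear_sum; apply: eq_bigr => i _; rewrite linearZ.
Qed.

Lemma iter_rmul_eq0 k u : (n <= k)%N -> iter k (rmul e) u = 0.
Proof.
move=> lenk; rewrite iter_rmulE big1 // => i _.
by rewrite rpower_eq0 ?scaler0 // (leq_trans lenk) ?leq_addr.
Qed.

(** In top degree the first factor, too, enters only through its coordinate
    along [e]; this makes the monomials of degree [n] symmetric. *)
Lemma iter_rmul_top k u : k.+1 = n ->
  iter k (rmul e) u = co 0%N u *: rpower e k.
Proof.
move=> Dn; rewrite iter_rmulE -Dn big_ord_recl addn0 big1 ?addr0 // => i _.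
by rewrite rpower_eq0 ?scaler0 // -Dn /= /bump addnS ltnS leq_addr.
Qed.

(** A product lies in [L^2], on which the coordinate along [e] vanishes. *)
Lemma co0_lmul u v : co 0%N (lmul u v) = 0.
Proof.
rewrite lmulE linearZ /= -[lmul u e]/(iter 1 (rmul e) u) iter_rmulE.
rewrite linear_sum big1 ?mulr0 // => i _.
by rewrite linearZ /= co_rpower // mulr0.
Qed.

Variables (D : leibnizType K) (x : nat -> D).

(** Each letter after the first acts as a scalar times right multiplication by
    [e], and these operators commute. *)
Lemma eval_word h q : is_leibniz_hom h ->
  h (word_mono x q) = (\prod_(i <- q.2) co 0%N (h (x i))) *:
                      iter (size q.2) (rmul e) (h (x q.1)).
Proof.
move=> hom_h; case: q => j w; rewrite /word_mono /=.
elim/last_ind: w => [|w i IHw]; first by rewrite big_nil scale1r.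
rewrite foldl_rcons (leibniz_homM hom_h) lmulE IHw size_rcons big_rcons /=.
by rewrite lmulZl scalerA mulrC.
Qed.

Lemma identitiesP f :
  f \in identities D L <-> forall h : D -> L, is_leibniz_hom h -> h f = 0.
Proof. by split=> [/asboolP | ?]; last exact/asboolP. Qed.

Definition reducible (P : set nat) (f : D) := exists l : seq (K * word),
  {in l, forall p, normal n p.2 /\ {in p.2.1 :: p.2.2, forall i, P i}} /\
  f - \sum_(p <- l) p.1 *: word_mono x p.2 \in identities D L.

Section Reducible.
Variable P : set nat.

Lemma reducible_congr f g : f - g \in identities D L ->
  reducible P g -> reducible P f.
Proof.
move=> fg [l [Nl gl]]; exists l; split=> //.
by rewrite -[f](subrK g) -addrA rpredD.
Qed.

Lemma reducible0 : reducible P 0.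
Proof. by exists [::]; rewrite big_nil subr0 rpred0. Qed.

Lemma reducibleZD a f g :
  reducible P f -> reducible P g -> reducible P (a *: f + g).
Proof.
move=> [l [Nl fl]] [l' [Nl' gl']].
exists ([seq (a * p.1, p.2) | p <- l] ++ l'); split=> [p|].
  by rewrite mem_cat => /orP[/mapP[q /Nl Nq ->] // | /Nl'].
rewrite big_cat big_map /= opprD addrACA rpredD //.
under eq_bigr do rewrite -scalerA.
by rewrite -scaler_sumr -scalerBr rpredZ.
Qed.

Lemma reducible_sum (T : eqType) (s : seq T) (c : T -> K) (b : T -> D) :
  {in s, forall q, reducible P (b q)} -> reducible P (\sum_(q <- s) c q *: b q).
Proof.
elim: s => [|q s IHs] red; first by rewrite big_nil; apply: reducible0.
rewrite big_cons; apply: reducibleZD; first by apply: red; rewrite mem_head.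
by apply: IHs => r rs; apply: red; rewrite inE rs orbT.
Qed.

(** Words of length above [n] vanish on [L]; otherwise the letters after the
    first one commute, and all letters do in length [n], so sorting gives a
    normal word. *)
Lemma reducible_word q : {in q.1 :: q.2, forall i, P i} ->
  reducible P (word_mono x q).
Proof.
case: q => j w /= Pjw.
have red1 j' w' : normal n (j', w') -> perm_eq (j :: w) (j' :: w') ->
    (word_mono x (j, w) - word_mono x (j', w') \in identities D L) ->
  reducible P (word_mono x (j, w)).
  move=> Nw' eqw idw; exists [:: (1, (j', w'))]; split=> [p|].
    rewrite inE => /eqP-> /=; split=> // i.
    by rewrite -(perm_mem eqw); apply: Pjw.
  by rewrite big_seq1 scale1r.
have [lenw | ltwn] := leqP n (size w).
  apply: reducible_congr reducible0; rewrite subr0.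
  apply/identitiesP => h hom_h.
  by rewrite eval_word // iter_rmul_eq0 // scaler0.
have [Dn | neqn] := eqVneq (size w).+1 n; last first.
  apply: (red1 j (sort leq w)).
  - rewrite /normal size_sort ltwn (negPf neqn) implyFb !andbT.
    exact/sort_sorted/leq_total.
  - by rewrite perm_cons perm_sym perm_sort.
  apply/identitiesP => h hom_h.
  rewrite (leibniz_homB hom_h) !eval_word //= size_sort.
  by rewrite (perm_big _ (permEl (perm_sort leq w))) subrr.
have := permEl (perm_sort leq (j :: w)); have := sort_sorted leq_total (j :: w).
case: sort => [|j' w'] srt eqw; first by have := perm_size eqw.
have sz : size w' = size w by have [] := perm_size eqw.
apply: (red1 j' w').
- by rewrite /normal sz ltwn (path_sorted srt) srt implybT.
- by rewrite perm_sym.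
apply/identitiesP => h hom_h; rewrite (leibniz_homB hom_h) !eval_word //= sz.
rewrite !iter_rmul_top // !scalerA.
pose F i := co 0%N (h (x i)).
have prodE k v : \prod_(i <- v) F i * F k = \prod_(i <- k :: v) F i.
  by rewrite big_cons mulrC.
by rewrite -/(F j) -/(F j') !prodE (perm_big _ eqw) subrr.
Qed.

(** A product sees its right factor only through the coordinate along [e],
    which vanishes on words of length at least two: only the letters among
    the right words contribute. *)
Lemma reducible_mul f g :
  reducible P f -> reducible P g -> reducible P (lmul f g).
Proof.
move=> [l [Nl /identitiesP fl]] [l' [Nl' /identitiesP gl']].
pose l1 := [seq p <- l' | p.2.2 == [::]].
apply: (@reducible_congr _ (\sum_(p <- l) p.1 *:
  \sum_(p' <- l1) p'.1 *: word_mono x (p.2.1, rcons p.2.2 p'.2.1))).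
  apply/identitiesP => h hom_h.
  have evalE u r : (forall h : D -> L, is_leibniz_hom h -> h (u - \sum_(p <- r)
      p.1 *: word_mono x p.2) = 0) ->
      h u = \sum_(p <- r) p.1 *: h (word_mono x p.2).
    move=> /(_ h hom_h)/eqP; rewrite (leibniz_homB hom_h) subr_eq0 => /eqP->.
    exact: leibniz_hom_sum.
  have hf := evalE _ _ fl; have hg := evalE _ _ gl'.
  rewrite (leibniz_homB hom_h) (leibniz_homM hom_h) (leibniz_hom_sum hom_h).
  have cog : co 0%N (h g) = \sum_(p <- l1) p.1 * co 0%N (h (x p.2.1)).
    rewrite hg linear_sum /l1 big_filter [RHS]big_mkcond.
    apply: eq_bigr => -[a [i w]] _ /=; rewrite linearZ /=.
    case: eqP => [-> //|]; elim/last_ind: w => // w k _ _.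
    by rewrite /word_mono foldl_rcons (leibniz_homM hom_h) co0_lmul mulr0.
  apply/eqP; rewrite subr_eq0 lmulE cog hf -/(rmul e _) linear_sum scaler_sumr.
  apply/eqP; apply: eq_bigr => p _; rewrite linearZ /= scalerA mulrC -scalerA.
  congr (_ *: _); rewrite (leibniz_hom_sum hom_h) scaler_suml.
  apply: eq_bigr => p' _.
  rewrite -scalerA; congr (_ *: _).
  by rewrite [in RHS]/word_mono foldl_rcons (leibniz_homM hom_h) lmulE.
apply: reducible_sum => p /Nl[_ Pp]; apply: reducible_sum => p'.
rewrite mem_filter => /andP[_ /Nl'[_ Pp']]; apply: reducible_word => i /=.
rewrite inE mem_rcons inE => /or3P[/eqP-> | /eqP-> | ip].
- by apply: Pp; rewrite mem_head.
- by apply: Pp'; rewrite mem_head.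
- by apply: Pp; rewrite inE ip orbT.
Qed.

Lemma reducible_gen f : f \in subalg_gen [set x i | i in P] -> reducible P f.
Proof.
move=> /asboolP; apply; split; last first.
  move=> _ [i Pi <-]; apply: (@reducible_word (i, [::])) => j.
  by rewrite /= inE => /eqP->.
by split; [apply: reducible0 | apply: reducibleZD | apply: reducible_mul].
Qed.

End Reducible.

(** Evaluate at [al i e + be i e^2] and compare coordinates. For words of length
    below [n] the part linear in [be] isolates the first letter and leaves a
    commutative monomial in [al]; in length [n] only the monomial in all the
    letters, which determines a normal word, remains. *)
Lemma normal_words_indep :
  infinite_set [set: K] -> is_free_leibniz x ->
  indep_mod (identities D L) [set q | normal n q] (word_mono x).
Proof.
move=> infK freeD s c Us Ns /identitiesP c0 q0 q0s.
have eqE d al be : (d < n)%N -> \sum_(q <- s) c q * \prod_(i <- q.2) al i *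
    (al q.1 * (size q.2 == d)%:R + be q.1 * ((size q.2).+1 == d)%:R) = 0.
  move=> ltdn; have [h [[hom_h hx] _]] :=
    freeD L (fun i => al i *: e + be i *: rpower e 1).
  move: (c0 h hom_h); rewrite (leibniz_hom_sum hom_h) => /(congr1 (co d)).
  rewrite linear0 linear_sum => cd0.
  rewrite -[RHS]cd0; apply: eq_bigr => q _.
  rewrite linearZ /= eval_word // linearZ /= -mulrA; congr (_ * (_ * _)).
    apply: eq_bigr => i _; rewrite hx linearD !linearZ /=.
    by rewrite -[e]/(rpower e 0) !co_rpower // mulr1 mulr0 addr0.
  have -> : iter (size q.2) (rmul e) (h (x q.1)) =
      al q.1 *: rpower e (size q.2) + be q.1 *: rpower e (size q.2).+1.
    rewrite hx; elim: (size q.2) => //= k ->.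
    by rewrite linearD !linearZ.
  by rewrite linearD !linearZ /= !co_rpower.
have /and3P[_ ltq0 _] := Ns q0 q0s.
have [Dn | neqn] := eqVneq (size q0.2).+1 n.
  pose s' := [seq q <- s | size q.2 == size q0.2].
  suff: {in s', forall q, c q = 0} by apply; rewrite mem_filter eqxx.
  apply: (@monomials_indep K _ s' (fun q => q.1 :: q.2) c infK).
  - exact: filter_uniq.
  - by move=> [i w] [j v] _ _ /= [-> ->].
  - move=> q; rewrite mem_filter => /andP[/eqP eqq /Ns/and3P[_ _]].
    by rewrite eqq Dn eqxx.
  - move=> al; rewrite -[RHS](eqE (size q0.2) al (fun=> 0)) // big_filter.
    rewrite big_mkcond; apply: eq_bigr => q _; rewrite mul0r addr0 big_cons.
    by case: eqP => _; rewrite ?mulr1 ?mulr0 // mulrCA mulrC -!mulrA.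
have ltn2 : ((size q0.2).+1 < n)%N by rewrite ltn_neqAle neqn.
pose s' := [seq q <- s | (size q.2 == size q0.2) && (q.1 == q0.1)].
suff: {in s', forall q, c q = 0} by apply; rewrite mem_filter !eqxx.
apply: (@monomials_indep K _ s' snd c infK).
- exact: filter_uniq.
- move=> [i w] [j v]; rewrite !mem_filter /=.
  by move=> /andP[/andP[_ /eqP->] _] /andP[/andP[_ /eqP->] _] ->.
- by move=> q; rewrite mem_filter => /andP[_ /Ns/and3P[]].
- move=> al; pose be i : K := (i == q0.1)%:R.
  rewrite -[RHS]subr0 -[X in _ = X - _](eqE _ al be ltn2).
  rewrite -[X in _ = _ - X](eqE _ al (fun=> 0) ltn2).
  rewrite -sumrB big_filter big_mkcond; apply: eq_bigr => q _.
  rewrite -mulrBr mul0r addr0 addrC addKr eqSS /be.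
  by case: eqP => _; case: eqP => _; rewrite ?mulr1 ?mulr0 // ?mul0r ?mulr0.
Qed.

End NullFiliformIdentities.

(** * Counting normal words *)

Section Counting.
Local Open Scope nat_scope.

Definition sorted_words (m k : nat) : seq (seq nat) :=
  [seq map val (tval t) |
     t <- enum [set t : k.-tuple 'I_m.+1 | sorted leq (map val t)]%SET].

Lemma size_sorted_words m k : size (sorted_words m k) = 'C(k + m, k).
Proof. by rewrite size_map -cardE card_sorted_tuples. Qed.

Lemma sorted_words_uniq m k : uniq (sorted_words m k).
Proof.
rewrite map_inj_uniq ?enum_uniq // => t t' /(inj_map val_inj) tt'.
exact: val_inj.
Qed.

Lemma mem_sorted_words m k w :
  (w \in sorted_words m k) = [&& sorted leq w, size w == k & all (gtn m.+1) w].
Proof.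
apply/mapP/and3P => [[t] | [sw /eqP szw ltw]].
  rewrite mem_enum inE => st ->; rewrite st size_map size_tuple eqxx.
  by split=> //; apply/allP => _ /mapP[i _ ->]; apply: (valP i).
have Dw : map val (map (@inord m) w) = w.
  by rewrite -map_comp map_id_in // => i /(allP ltw) lti; rewrite /= inordK.
have szt : size (map (@inord m) w) == k by rewrite size_map szw.
by exists (Tuple szt); rewrite ?mem_enum ?inE /= Dw.
Qed.

(** The top degree is listed separately: there a normal word is a sorted word of
    length [n] cut after its first letter. *)
Definition normal_words (m n : nat) : seq word :=
  flatten [seq [seq (j, w) | j <- iota 0 m.+1, w <- sorted_words m k]
             | k <- iota 0 n.-1] ++
  [seq (head 0 v, behead v) | v <- sorted_words m n].

Lemma mem_normal_words m n q : 0 < n ->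
  (q \in normal_words m n) = normal n q && all (gtn m.+1) (q.1 :: q.2).
Proof.
case: n q => // n [j w] _; rewrite mem_cat /normal /= ltnS eqSS.
have -> : ((j, w) \in [seq (head 0 v, behead v) | v <- sorted_words m n.+1])
    = ((j :: w) \in sorted_words m n.+1).
  apply/mapP/idP => [[[|i v]] | jw]; last by exists (j :: w).
    by rewrite mem_sorted_words.
  by move=> iv [-> ->].
rewrite mem_sorted_words /= eqSS.
have -> : ((j, w) \in flatten [seq [seq (j0, w0) | j0 <- iota 0 m.+1,
    w0 <- sorted_words m k] | k <- iota 0 n]) =
    [&& sorted leq w, size w < n, j < m.+1 & all (gtn m.+1) w].
  apply/flatten_mapP/and4P => [[k] | [sw ltwn ltjm ltwm]].
    rewrite mem_iota => ltkn /allpairsP[[i v] []].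
    by rewrite mem_iota mem_sorted_words => im /and3P[? /eqP szv ?] [-> ->];
      rewrite szv.
  exists (size w); first by rewrite mem_iota.
  by apply/allpairs_f; rewrite ?mem_iota ?mem_sorted_words ?sw ?eqxx.
rewrite [size w <= n]leq_eqVlt; case: eqVneq => [->|_] /=.
  rewrite ltnn andbF /=; case pjw: (path leq j w); last by rewrite andbF.
  by rewrite (path_sorted (pjw : path leq j w)).
by rewrite andbF orbF andbT -!andbA.
Qed.

Lemma flatten_uniq (S T : eqType) (s : seq S) (F : S -> seq T) (g : T -> S) :
  uniq s -> (forall k, uniq (F k)) -> (forall k q, q \in F k -> g q = k) ->
  uniq (flatten [seq F k | k <- s]).
Proof.
move=> Us UF gF; elim: s Us => //= k s IHs /andP[nks /IHs Us].
rewrite cat_uniq UF Us andbT /=; apply/hasPn => q /flatten_mapP[k' k's qk'].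
by apply/negP => /gF Dk; rewrite -Dk (gF _ _ qk') k's in nks.
Qed.

Lemma normal_words_uniq m n : 0 < n -> uniq (normal_words m n).
Proof.
case: n => // n _; rewrite cat_uniq; apply/and3P; split.
- apply: (@flatten_uniq _ _ _ _ (size \o snd)) => [|k|k q].
  + exact: iota_uniq.
  + rewrite allpairs_uniq ?iota_uniq ?sorted_words_uniq //.
    by move=> -[? ?] [? ?] _ _ [-> ->].
  + case/allpairsP=> -[j w] /= [_]; rewrite mem_sorted_words.
    by case/and3P=> _ /eqP szw _ ->.
- apply/hasPn => q /mapP[v]; rewrite mem_sorted_words.
  case/and3P=> _ /eqP szv _ ->.
  apply/negP => /flatten_mapP[k]; rewrite mem_iota => /andP[_ ltkn].
  case/allpairsP=> -[j w] [_]; rewrite mem_sorted_words.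
  case/and3P=> _ /eqP szw _ [_ Dw]; move: ltkn.
  by rewrite add0n -szw -Dw size_behead szv ltnn.
have consE v : v \in sorted_words m n.+1 -> v = head 0 v :: behead v.
  by rewrite mem_sorted_words; case: v => // /and3P[].
rewrite map_inj_in_uniq ?sorted_words_uniq // => v v' /consE Dv /consE Dv'.
by case=> eq_head eq_behead; rewrite Dv Dv' eq_head eq_behead.
Qed.

(** Both sides count the multisets of size [k + 1] on [m + 1] letters with a
    marked element of the support: on the left by the size [l] of the support, on
    the right by the marked letter and the multiset left when one copy of it is
    removed. *)
Lemma marked_multisets m k :
  \sum_(1 <= l < (minn m.+1 k.+1).+1) l * 'C(m.+1, l) * 'C(k, l - 1) =
  m.+1 * 'C(k + m, k).
Proof.
rewrite big_add1 minnSS /= addnC -binomial.Vandermonde big_distrr /=.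
rewrite -(big_mkord xpredT (fun i => m.+1 * ('C(m, i) * 'C(k, k - i)))).
rewrite [RHS](big_cat_nat (n := (minn m k).+1)) //= ?ltnS ?geq_minr //.
rewrite [X in _ = _ + X]big_nat_cond [X in _ = _ + X]big1 ?addn0.
  apply: eq_big_nat => i /andP[_]; rewrite ltnS leq_min => /andP[_ leik].
  by rewrite subn1 bin_sub // mulnA -mul_bin_diag.
move=> i; rewrite andbT gtn_min => /andP[/orP[ltmi | ltki] ltik].
  by rewrite (bin_small ltmi) mul0n muln0.
by rewrite ltnS leqNgt ltki in ltik.
Qed.

Lemma size_normal_words m n : 0 < n ->
  size (normal_words m n) =
  'C(n + m.+1 - 1, m.+1 - 1) +
  \sum_(1 <= s < n) \sum_(1 <= l < (minn m.+1 s).+1)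
     l * 'C(m.+1, l) * 'C(s - 1, l - 1).
Proof.
case: n => // n _; rewrite size_cat size_map size_sorted_words addnC.
congr (_ + _).
  by rewrite addnS !subn1 /= -[in RHS](bin_sub (leq_addl n.+1 m)) addnK.
rewrite size_flatten sumnE !big_map big_add1 -[in LHS](subn0 n.+1.-1).
apply: eq_bigr => k _; rewrite size_allpairs size_iota size_sorted_words.
by rewrite subn1 -marked_multisets.
Qed.

End Counting.

Unset Implicit Arguments.

Theorem corollary8 (K : fieldType) (hK : infinite_set [set: K])
    (n : nat) (hn : (0 < n)%N)
    (L : finLeibnizType K) (hL : null_filiform L n)
    (D : leibnizType K) (x : nat -> D) (hD : is_free_leibniz x) :
  is_basis [set \pi_(relfree D L) g | g in basis_monomials x n] /\
  forall m : nat, (1 <= m)%N ->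
    has_dim (relfree_rank x L m)
      ('C(n + m - 1, m - 1) +
       \sum_(1 <= s < n) \sum_(1 <= l < (minn m s).+1)
          l * 'C(m, l) * 'C(s - 1, l - 1))%N.
Proof.
have [e [co [mulE co_pow coE]]] := null_filiform_coordinates hL hn.
have indep := normal_words_indep hn mulE co_pow hK hD.
split=> [|[//|m] _].
  rewrite basis_monomials_normal // image_comp.
  apply: (quotmod_basis indep) => f.
  have [l [Nl fl]] := reducible_gen hn mulE co_pow coE (free_leibniz_gen hD f).
  by exists l; split=> // p /Nl[].
pose I : submodClosed _ := @rank_identities K D x L m.+1.
have memI u : (u \in I) = (val u \in identities D L) by [].
pose b q : free_rank x m.+1 := insubd 0 (word_mono x q).
pose N := [set q | q \in normal_words m n].
have bE q : N q -> val (b q) = word_mono x q.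
  rewrite /N /= mem_normal_words // => /andP[_ /allP lt_q].
  by rewrite val_insubd word_mono_gen // => i /lt_q.
have sumE (T : eqType) (s : seq T) (c : T -> K) (g : T -> word) :
    {in s, forall p, N (g p)} ->
    val (\sum_(p <- s) c p *: b (g p)) = \sum_(p <- s) c p *: word_mono x (g p).
  move=> Ns; rewrite raddf_sum big_seq [RHS]big_seq.
  by apply: eq_bigr => p /Ns Np; rewrite -bE.
have indep_rank : indep_mod I N b.
  move=> s c Us Ns; rewrite memI (sumE _ _ _ id) //.
  apply: (indep s c Us) => q /Ns.
  by rewrite /N /= mem_normal_words // => /andP[].
have span_rank : spans_mod I N b.
  move=> u; have [l [Nl ul]] := reducible_gen hn mulE co_pow coE (valP u).
  have Nl' : {in l, forall p, N p.2}.
    move=> p /Nl[Np lt_p]; rewrite /N /= mem_normal_words // Np.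
    by apply/allP => i /lt_p.
  by exists l; split=> //; rewrite memI raddfB /= sumE.
exists [seq \pi_(quotmod I) (b q) | q <- normal_words m n]; split.
- rewrite map_inj_in_uniq ?normal_words_uniq // => q q' Nq Nq'.
  by apply: (indep_mod_inj indep_rank); rewrite inE.
- by rewrite size_map size_normal_words.
rewrite (_ : [set` _] = [set \pi_(quotmod I) (b q) | q in N]).
  exact: quotmod_basis.
apply/seteqP; split=> v /=; first by case/mapP=> q Nq ->; exists q.
by case=> q Nq <-; apply: map_f.
Qed.
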